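(* Let $k\geq2$, let $X$ be a countably based $T_0$-space, let $\delta:D\to X$ ($D\subseteq\mathcal{N}$) be an admissible representation of $X$, let $A:X\to k$ be a $k$-partition of $X$, let $\theta\geq1$ be a countable ordinal and let $F$ be a countable $k$-forest. Then $A\in\mathbf{\Sigma}^0_\theta(X,F)$ if and only if $A\circ\delta\in\mathbf{\Sigma}^0_\theta(D,F)$, where $D$ carries the subspace topology of $\mathcal{N}$.
   Context: $\mathcal{N}=\omega^\omega$ is the Baire space. An admissible representation of $X$ is a continuous surjection $\delta:D\to X$ with $D\subseteq\mathcal{N}$ such that for every $Z\subseteq\mathcal{N}$ and every continuous $\nu:Z\to X$ there is a continuous $g:Z\to\mathcal{N}$ with $\nu=\delta\circ g$. For a space $Y$: $\mathbf{\Sigma}^0_1(Y)$ the open sets; $\mathbf{\Sigma}^0_2(Y)$ the countable unions of sets $U\setminus V$ with $U,V$ open; for $2<\alpha<\omega_1$, $\mathbf{\Sigma}^0_\alpha(Y)$ the countable unions of complements of sets in $\bigcup_{\beta<\alpha}\mathbf{\Sigma}^0_\beta(Y)$ (with $\mathbf{\Sigma}^0_0(Y)=\{\emptyset\}$). A countable $k$-forest is a countable poset $(P;\leq)$ without infinite chains in which every upper cone $\{y\mid x\leq y\}$ is a chain, with a labeling $c:P\to k=\{0,\dots,k-1\}$. $\mathbf{\Sigma}^0_\theta(Y,F)$ is the set of $k$-partitions $A:Y\to k$ for which there exist $B_p\in\mathbf{\Sigma}^0_\theta(Y)$ ($p\in F$) with $\bigcup_pB_p=Y$ and $A^{-1}(i)=\bigcup\{B_p\setminus\bigcup_{q<p}B_q\mid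 c(p)=i\}$ for each $i<k$. *)

(* Defs.v *)
From HB Require Import structures.
From mathcomp Require Import all_boot all_order all_algebra.
From mathcomp Require Import all_classical all_reals all_analysis.
Set Implicit Arguments. Unset Strict Implicit. Unset Printing Implicit Defensive.
Local Open Scope classical_set_scope.

Definition BaireN : topologicalType := {ptws nat -> nat}.

Definition sub_open (T : topologicalType) (D : set T) (S : set {x : T | D x}) : Prop :=
  exists2 U : set T, open U & S = (@proj1_sig T D) @^-1` U.

(** Admissible representation delta : D -> X (D ⊆ N), delta given as a total
    function on N whose values outside D are irrelevant.  Continuity of a map
    defined on Z ⊆ N is continuity for the subspace topology on Z
    ({within Z, continuous f}). *)
Definition admissible (X : topologicalType) (D : set BaireN) (delta : BaireN -> X) : Prop :=
  [/\ {within D, continuous delta},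
      (forall x : X, exists2 d, D d & delta d = x) &
      (forall (Z : set BaireN) (nu : BaireN -> X), {within Z, continuous nu} ->
         exists g : BaireN -> BaireN,
           [/\ {within Z, continuous g},
               (forall z, Z z -> D (g z)) &
               (forall z, Z z -> nu z = delta (g z))])].

(** Countable ordinals.  An ordinal is represented by an element theta of a
    well-ordered type (I, lt) (strict total order, well-founded); theta is a
    countable ordinal when its set of predecessors is countable.  The Borel
    classes below only depend on the order type of the predecessors. *)
Definition strict_well_order (I : Type) (lt : I -> I -> Prop) : Prop :=
  [/\ (forall a, ~ lt a a),
      (forall a b c, lt a b -> lt b c -> lt a c),
      (forall a b, lt a b \/ a = b \/ lt b a) &
      well_founded lt].

Definition ord_is0 (I : Type) (lt : I -> I -> Prop) (a : I) := forall b, ~ lt b a.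
Definition ord_is1 (I : Type) (lt : I -> I -> Prop) (a : I) :=
  exists b, lt b a /\ forall c, lt c a -> c = b.
Definition ord_is2 (I : Type) (lt : I -> I -> Prop) (a : I) :=
  exists b1 b2, [/\ lt b1 b2, lt b2 a & forall c, lt c a -> c = b1 \/ c = b2].
Definition ord_gt2 (I : Type) (lt : I -> I -> Prop) (a : I) :=
  exists b1 b2 b3, [/\ lt b1 b2, lt b2 b3 & lt b3 a].

Inductive Sigma0 (I : Type) (lt : I -> I -> Prop) (Y : Type) (op : set Y -> Prop)
  : I -> set Y -> Prop :=
| Sigma0_zero a : ord_is0 lt a -> Sigma0 lt op a set0
| Sigma0_one a S : ord_is1 lt a -> op S -> Sigma0 lt op a S
| Sigma0_two a (U V : nat -> set Y) :
    ord_is2 lt a -> (forall n, op (U n) /\ op (V n)) ->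
    Sigma0 lt op a (\bigcup_n (U n `\` V n))
| Sigma0_gt2 a (C : nat -> set Y) :
    ord_gt2 lt a ->
    (forall n, exists2 b, lt b a & Sigma0 lt op b (~` C n)) ->
    Sigma0 lt op a (\bigcup_n C n).

Definition is_chain (P : Type) (le : P -> P -> Prop) (C : set P) : Prop :=
  forall x y, C x -> C y -> le x y \/ le y x.

Definition countable_forest (P : Type) (le : P -> P -> Prop) : Prop :=
  [/\ (forall x, le x x),
      (forall x y, le x y -> le y x -> x = y)
      & (forall x y z, le x y -> le y z -> le x z)] /\
  [/\ countable [set: P],
      (forall C : set P, is_chain le C -> finite_set C) &
      (forall x, is_chain le [set y | le x y])].

Definition SigmaF (I : Type) (lt : I -> I -> Prop) (Y : Type) (op : set Y -> Prop)
  (theta : I) (k : nat) (P : Type) (le : P -> P -> Prop) (c : P -> 'I_k)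
  (A : Y -> 'I_k) : Prop :=
  exists B : P -> set Y,
    [/\ (forall p, Sigma0 lt op theta (B p)),
        \bigcup_p B p = [set: Y] &
        (forall i : 'I_k, A @^-1` [set i] =
           \bigcup_(p in [set p | c p = i])
              (B p `\` \bigcup_(q in [set q | le q p /\ q <> p]) B q))].

(* Main.v *)
Require Import Defs.
From HB Require Import structures.
From mathcomp Require Import all_boot all_order all_algebra.
From mathcomp Require Import all_classical all_reals all_analysis.
Set Implicit Arguments. Unset Strict Implicit. Unset Printing Implicit Defensive.
Local Open Scope classical_set_scope.

(** Let [U] enumerate a base of [X] and call [f] a name of [x] when [f]
    enumerates [{n | U n x}].  Sending names to points is a continuous map
    [rho : names -> X], so by admissibility [rho = delta \o g] with [g]
    continuous, and it suffices to descend along [rho].  The fiber of [rho] over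
    [x] is comeager in the sequences over [{n | U n x}], hence a Baire space.
    Given a witness [B_p] for [A \o rho], let [G_p] be the set of points over
    whose fiber [B_p] is nonmeager; the category quantifier preserves the class
    Sigma^0_theta.  The [G_p] cover [X], and if [x] lies in [G_p] but in no [G_q]
    with [q < p], then some name of [x] lies in [B_p] but in no such [B_q],
    because the forest is countable.  Hence [A x = c p]. *)

(** * Baire category in the fibers of the standard representation *)

Lemma prefix_mkseq (f : nat -> nat) (m n : nat) :
  (m <= n)%N -> prefix (mkseq f m) (mkseq f n).
Proof.
by move=> mn; rewrite prefixE size_mkseq -map_take take_iota (minn_idPl mn).
Qed.

Section FiberCategory.
Variables (X : Type) (U : nat -> set X).
(** With the whole space at index 0, the letter 0 belongs to every {n | U n x}, so a finite sequence
    over that set can always be prolonged by zeros. *)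
Hypothesis U0 : forall x, U 0 x.

Definition enumerates (f : nat -> nat) (x : X) : Prop :=
  forall n, U n x <-> exists i, f i = n.

Definition names : set (nat -> nat) := [set f | exists x, enumerates f x].

(** The image, under the standard representation, of the names that begin with [s]: when all letters
    of [s] lie in {n | U n x}, [s] extends to a name of [x]. *)
Definition cylinder_image (s : seq nat) : set X :=
  [set x | forall n, n \in s -> U n x].

(** [O] stands for the union of the cylinders of its members, an open set required to be dense in
    the part of the fiber over [x] inside the cylinder [s]. *)
Definition dense_above (x : X) (s : seq nat) (O : set (seq nat)) : Prop :=
  forall t, prefix s t -> cylinder_image t x ->
    exists u, [/\ prefix t u, cylinder_image u x & O u].

(* Comeager in the part of the fiber over [x] that lies in the cylinder [s]; the
   finite sequences over [{n | U n x}] are those [t] with [cylinder_image t x]. *)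
Definition comeager (x : X) (s : seq nat) (S : set {f | names f}) : Prop :=
  exists O : nat -> set (seq nat),
    (forall n, dense_above x s (O n)) /\
    (forall y : {f | names f}, enumerates (proj1_sig y) x ->
       mkseq (proj1_sig y) (size s) = s ->
       (forall n, exists m, O n (mkseq (proj1_sig y) m)) -> S y).

Lemma comeager_countable (J : countType) (O : J -> set (seq nat)) x s
    (S : set {f | names f}) :
  (forall j, dense_above x s (O j)) ->
  (forall y : {f | names f}, enumerates (proj1_sig y) x ->
     mkseq (proj1_sig y) (size s) = s ->
     (forall j, exists m, O j (mkseq (proj1_sig y) m)) -> S y) ->
  comeager x s S.
Proof.
move=> dO HS.
exists (fun n => if unpickle n is Some j then O j else setT); split=> [n|y yx ys Oy].
  by case: (unpickle n) => [j|] // t st tx; exists t; split => //; exact: prefix_refl.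
by apply: HS => // j; have := Oy (pickle j); rewrite pickleK.
Qed.

Lemma comeager_mono x s (S S' : set {f | names f}) :
  (forall y, enumerates (proj1_sig y) x -> mkseq (proj1_sig y) (size s) = s ->
     S y -> S' y) ->
  comeager x s S -> comeager x s S'.
Proof. by move=> SS' [ O [dO HO]]; exists O; split=> // y yx ys /HO; auto. Qed.

Lemma comeager_setT x s : comeager x s setT.
Proof.
exists (fun _ => setT); split=> // n t st tx.
by exists t; split=> //; exact: prefix_refl.
Qed.

Lemma comeager_prefix x s t (S : set {f | names f}) :
  prefix s t -> comeager x s S -> comeager x t S.
Proof.
move=> st [ O [dO HO]]; exists O; split=> [n u tu|y yx yt].
  exact: dO (prefix_trans st tu).
apply: HO => //; move: st; rewrite prefixE => /eqP st.
have les : (size s <= size t)%N by rewrite -st size_take_min geq_minr.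
by rewrite -{2}st -yt -map_take take_iota (minn_idPl les).
Qed.

Lemma comeager_bigcap x s (S : nat -> set {f | names f}) :
  (forall n, comeager x s (S n)) -> comeager x s (\bigcap_n S n).
Proof.
move=> /choice[ O HO].
apply: (@comeager_countable (nat * nat)%type (fun p => O p.1 p.2)).
  by move=> [n m]; have [] := HO n.
move=> y yx ys Oy n _; have [_ H] := HO n; apply: H => // m.
exact: (Oy (n, m)).
Qed.

Lemma comeager_bigcap_countable (P : Type) x s (Q : set P)
    (S : P -> set {f | names f}) : countable [set: P] ->
  (forall p, Q p -> comeager x s (S p)) -> comeager x s (\bigcap_(p in Q) S p).
Proof.
move=> /countable_injP[f finj] HS.
have : comeager x s (\bigcap_n [set y | forall p, f p = n -> Q p -> S p y]).
  apply: comeager_bigcap => n.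
  have [[p [fp Qp]]|np] := pselect (exists p, f p = n /\ Q p).
    apply: comeager_mono (HS p Qp) => y _ _ Spy q fq _.
    by rewrite (finj q p) ?inE ?fp.
  apply: comeager_mono (comeager_setT x s) => y _ _ _ p fp Qp.
  by case: np; exists p.
by apply: comeager_mono => y _ _ HSy p Qp; exact: (HSy (f p) Logic.I).
Qed.

Lemma comeager_setI x s (S S' : set {f | names f}) :
  comeager x s S -> comeager x s S' -> comeager x s (S `&` S').
Proof.
move=> cS cS'.
have : comeager x s (\bigcap_n if n is 0%N then S else S').
  by apply: comeager_bigcap => -[].
apply: comeager_mono => y _ _ Sy.
by split; [exact: (Sy 0%N Logic.I)|exact: (Sy 1%N Logic.I)].
Qed.

Lemma cylinder_image_rcons x s n :
  cylinder_image s x -> U n x -> cylinder_image (rcons s n) x.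
Proof. by move=> sx nx m; rewrite mem_rcons inE => /predU1P[->|/sx]. Qed.

(* The Baire category theorem in the fiber over [x]. *)
Lemma comeager_nonempty x s (S : set {f | names f}) :
  cylinder_image s x -> comeager x s S ->
  exists y : {f | names f}, enumerates (proj1_sig y) x /\ S y.
Proof.
move=> sx [ O [dO HO]].
have [g Hg] : exists g : nat -> seq nat -> seq nat, forall n t,
    prefix s t -> cylinder_image t x ->
    [/\ prefix t (g n t), cylinder_image (g n t) x & O n (g n t)].
  have H (p : nat * seq nat) : exists u, prefix s p.2 -> cylinder_image p.2 x ->
      [/\ prefix p.2 u, cylinder_image u x & O p.1 u].
    have [[sp px]|np] := pselect (prefix s p.2 /\ cylinder_image p.2 x).
      by have [u Hu] := dO p.1 _ sp px; exists u.
    by exists [::] => ? ?; case: np.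
  have [h Hh] := choice H.
  by exists (fun n t => h (n, t)) => n t; exact: (Hh (n, t)).
(* The letter appended at stage [n]: [n] itself if it is allowed over [x], and otherwise 0, which
   always is. *)
pose e n := if pselect (U n x) then n else 0%N.
have ex n : U (e n) x by rewrite /e; case: pselect.
(* Each stage first enters the next dense set and then appends a letter, so the limit meets every
   [O m] and enumerates exactly {n | U n x}. *)
pose R := fix R n := if n is m.+1 then rcons (g m (R m)) (e m) else s.
have HR n : prefix s (R n) /\ cylinder_image (R n) x.
  elim: n => [|n [sR Rx]] /=; first by rewrite prefix_refl.
  have [Rg gx _] := Hg n _ sR Rx; split; last exact: cylinder_image_rcons.
  exact: prefix_trans sR (prefix_trans Rg (prefix_rcons _ _)).
have RS n : [/\ prefix (R n) (g n (R n)), cylinder_image (g n (R n)) x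
    & O n (g n (R n))] by have [? ?] := HR n; exact: Hg.
have Rmono m n : (m <= n)%N -> prefix (R m) (R n).
  move=> /subnK <-; elim: (n - m)%N => [|d IH]; first exact: prefix_refl.
  have [h _ _] := RS (d + m)%N.
  exact: prefix_trans IH (prefix_trans h (prefix_rcons _ _)).
have Rsize n : (n <= size (R n))%N.
  elim: n => //= n IH; rewrite size_rcons ltnS; apply: leq_trans IH _.
  by have [h _ _] := RS n; exact: size_prefix.
have Rnth m n i : (m <= n)%N -> (i < size (R m))%N -> nth 0%N (R n) i = nth 0%N (R m) i.
  move=> /Rmono; rewrite prefixE => /eqP {2}<- im; rewrite nth_take //.
(* Every stage adds at least one letter, so position [i] is settled in [R i.+1]. *)
pose f i := nth 0%N (R i.+1) i.
have fE n i : (i < size (R n))%N -> f i = nth 0%N (R n) i.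
  move=> iR; rewrite /f; case: (leqP n i.+1) => [h|/ltnW h]; first exact: Rnth.
  by rewrite (Rnth _ _ _ h) // Rsize.
have fR n t : prefix t (R n) -> mkseq f (size t) = t.
  move=> tR; apply: (@eq_from_nth _ 0%N); rewrite size_mkseq // => i it.
  rewrite nth_mkseq //; move: (tR); rewrite prefixE => /eqP tE.
  rewrite (fE n) ?(leq_trans it (size_prefix tR)) //.
  by rewrite -tE nth_take.
have fx : enumerates f x.
  move=> n; split=> [nx|[i <-]].
    exists (size (g n (R n))); rewrite (fE n.+1) /= ?size_rcons //.
    by rewrite nth_rcons ltnn eqxx /e; case: pselect.
  have [_ H] := HR i.+1; apply: H; rewrite /f mem_nth //; exact: Rsize.
have Ef : names f by exists x.
exists (exist _ f Ef); split => //; apply: HO => //=.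
  exact: (fR 0%N _ (prefix_refl _)).
move=> n; exists (size (g n (R n))).
by rewrite (fR n.+1) ?prefix_rcons //; have [] := RS n.
Qed.

(** There are only countably many finite sequences, so the dense families witnessing comeagerness
    above each of them merge into one countable family. This is the localization principle for
    category. *)
Lemma comeager_local x s (S : set {f | names f}) :
  (forall t, prefix s t -> cylinder_image t x ->
     exists u, [/\ prefix t u, cylinder_image u x & comeager x u S]) ->
  comeager x s S.
Proof.
move=> locS.
have locO t : exists O : nat -> set (seq nat), comeager x t S ->
    (forall n, dense_above x t (O n)) /\
    (forall y : {f | names f}, enumerates (proj1_sig y) x ->
       mkseq (proj1_sig y) (size t) = t ->
       (forall n, exists m, O n (mkseq (proj1_sig y) m)) -> S y).
  have [[ O HO]|nc] := pselect (comeager x t S); first by exists O.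
  by exists (fun _ => setT) => /nc.
have [ O HO] := choice locO.
(* [None] makes a name enter some [t] above which [S] is comeager; [Some (t, m)]
   handles the [m]-th dense set above [t] once the name is known to extend [t]. *)
pose O' (p : option (seq nat * nat)) : set (seq nat) :=
  if p is Some (t, m)
  then [set w | comeager x t S ->
         (size t <= size w)%N /\ (prefix t w -> O t m w)]
  else [set t | comeager x t S].
apply: (@comeager_countable _ O').
  move=> [[t m]|] v sv vx /=; last exact: locS.
  have [ct|nc] := pselect (comeager x t S); last first.
    by exists v; split => //; exact: prefix_refl.
  (* Padding makes [w] at least as long as [t], so either [w] extends [t] or the two are
     incompatible. *)
  pose w := v ++ nseq (size t) 0%N.
  have vw : prefix v w by exact: prefix_prefix.
  have tw : (size t <= size w)%N by rewrite size_cat size_nseq leq_addl.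
  have wx : cylinder_image w x.
    by move=> n; rewrite mem_cat => /orP[/vx//|/nseqP[-> _]]; exact: U0.
  have [ptw|nptw] := boolP (prefix t w); last first.
    by exists w; split => // _; split=> // ptw; rewrite ptw in nptw.
  have [dO _] := HO t ct; have [u [wu ux Ou]] := dO m w ptw wx.
  exists u; split=> //; first exact: prefix_trans vw wu.
  by move=> _; split=> //; exact: leq_trans tw (size_prefix wu).
move=> y yx ys Oy; have [k /= ck] := Oy None.
have [_ H] := HO _ ck; apply: H => //; first by rewrite size_mkseq.
move=> n; have [m /= Om] := Oy (Some (mkseq (proj1_sig y) k, n)).
exists m; have [km H] := Om ck; apply: H; apply: prefix_mkseq.
by rewrite !size_mkseq in km.
Qed.
End FiberCategory.

(** Otherwise there are points outside [W] agreeing with [f] on ever longer initial segments; they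
    converge pointwise to [f], hence enter [W]. *)
Lemma open_baire (W : set BaireN) (f : BaireN) :
  open W -> W f -> exists m, forall g, mkseq g m = mkseq f m -> W g.
Proof.
move=> oW Wf; apply: contrapT => nex.
have /choice[g Hg] m : exists g : BaireN, mkseq g m = mkseq f m /\ ~ W g.
  apply: contrapT => nexg; apply: nex; exists m => g gf.
  by apply: contrapT => nWg; apply: nexg; exists g.
have cvg_gf : {ptws, g @ \oo --> f}.
  apply/pointwise_cvgP => t; apply: cvg_near_cst.
  exists t.+1 => // m /= tm.
  have [gf _] := Hg m; apply/eqP.
  by rewrite -(nth_mkseq 0%N (g m) tm) gf nth_mkseq.
have /cvg_gf[n _ Hn] : nbhs f W by exact: open_nbhs_nbhs.
by have [_] := Hg n; apply; apply: Hn => /=.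
Qed.

(** * Small ordinals and the Borel hierarchy *)

Section WellOrder.
Variables (I : Type) (lt : I -> I -> Prop).
Hypothesis lt_wo : strict_well_order lt.

Lemma ord_min (Q : set I) a : Q a ->
  exists m, [/\ Q m, (forall b, lt b m -> ~ Q b) & m = a \/ lt m a].
Proof.
have [irr tr tot wf] := lt_wo.
elim/(well_founded_ind wf): a => a IH Qa.
have [[b [ba Qb]]|nex] := pselect (exists b, lt b a /\ Q b).
  have [m [Qm mmin mb]] := IH b ba Qb; exists m; split=> //; right.
  by case: mb => [->|mb] //; exact: tr mb ba.
by exists a; split=> // [b ba Qb|]; [apply: nex; exists b|left].
Qed.

(** The three least elements [z0], [z1], [z2] lie at or below [b1], [b2], [b3] respectively; [z1]
    and [z2] are the ordinals 1 and 2. *)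
Lemma ord_gt2_is12 a : ord_gt2 lt a ->
  exists z1 z2, [/\ ord_is1 lt z1, ord_is2 lt z2, lt z1 a & lt z2 a].
Proof.
have [irr tr tot wf] := lt_wo.
move=> [b1 [b2 [b3 [b12 b23 b3a]]]].
have [z0 [_ z0min z0b]] := @ord_min setT b1 Logic.I.
have z0b2 : lt z0 b2 by case: z0b => [->|z0b] //; exact: tr z0b b12.
have [z1 [z01 z1min z1b]] := @ord_min [set z | lt z0 z] b2 z0b2.
have z1b3 : lt z1 b3 by case: z1b => [->|z1b] //; exact: tr z1b b23.
have [z2 [z12 z2min z2b]] := @ord_min [set z | lt z1 z] b3 z1b3.
have below1 c : lt c z1 -> c = z0.
  move=> /z1min; case: (tot z0 c) => [//|[//|/z0min]].
  by case.
exists z1, z2; split.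
- by exists z0.
- exists z0, z1; split=> // c /z2min; case: (tot z1 c) => [//|[->|/below1->]] _.
    by right.
  by left.
- exact: tr z1b3 b3a.
- by case: z2b => [->|z2b] //; exact: tr z2b b3a.
Qed.

Lemma Sigma0_preimage (Y Z : Type) (opY : set Y -> Prop) (opZ : set Z -> Prop)
    (h : Y -> Z) : (forall S, opZ S -> opY (h @^-1` S)) ->
  forall a S, Sigma0 lt opZ a S -> Sigma0 lt opY a (h @^-1` S).
Proof.
have [_ _ _ wf] := lt_wo; move=> hop a.
elim/(well_founded_ind wf): a => a IH S HS.
case: HS IH => {}a.
- by move=> a0 _; rewrite preimage_set0; exact: Sigma0_zero.
- by move=> {}S a1 oS _; apply: Sigma0_one => //; exact: hop.
- move=> U V a2 UV _; rewrite preimage_bigcup.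
  apply: (Sigma0_two (U := fun n => h @^-1` U n) (V := fun n => h @^-1` V n)) => // n.
  by have [? ?] := UV n; split; exact: hop.
- move=> C a3 HC IH; rewrite preimage_bigcup; apply: Sigma0_gt2 => // n.
  by have [b ba Cb] := HC n; exists b => //; rewrite preimage_setC; exact: IH.
Qed.

Lemma Sigma0_closedU (X : topologicalType) (a b : I) (V G : set X) :
  ord_gt2 lt a -> lt b a -> open V -> Sigma0 lt open b G ->
  exists2 b', lt b' a & Sigma0 lt open b' (~` V `|` G).
Proof.
move=> a3 ba oV HG; have [z1 [z2 [z1o z2o z1a z2a]]] := ord_gt2_is12 a3.
have two (W : set X) : open W -> exists2 b', lt b' a & Sigma0 lt open b' (~` V `|` W).
  move=> oW; exists z2 => //.
  pose UU n : set X := if n is 0%N then setT else W.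
  pose VV n : set X := if n is 0%N then V else set0.
  rewrite (_ : _ `|` _ = \bigcup_n (UU n `\` VV n)).
    apply: Sigma0_two => // n; case: n => [|n]; split => //=.
    - exact: openT.
    - exact: open0.
  apply/seteqP; split=> x /=.
    by case=> [nV|Wx]; [exists 0%N|exists 1%N] => //=; split.
  by move=> [[|n] _ [/= ? ?]]; [left|right].
case: HG ba => {}b.
- by move=> _ _; apply: two; exact: open0.
- by move=> S _ oS _; apply: two.
- move=> U W b2 UW ba; exists b => //.
  pose UU n : set X := if n is m.+1 then U m else setT.
  pose VV n : set X := if n is m.+1 then W m else V.
  rewrite (_ : _ `|` _ = \bigcup_n (UU n `\` VV n)).
    apply: Sigma0_two => // n; case: n => [|n] /=; last exact: UW.
    by split=> //; exact: openT.
  apply/seteqP; split=> x /=.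
    by case=> [nV|[n _ Ux]]; [exists 0%N|exists n.+1] => //=; split.
  by move=> [[|n] _ Ux]; [left; case: Ux|right; exists n].
- move=> C b3 HC ba; exists b => //.
  have [y1 [_ [y1o _ y1b _]]] := ord_gt2_is12 b3.
  pose CC n : set X := if n is m.+1 then C m else ~` V.
  rewrite (_ : _ `|` _ = \bigcup_n CC n).
    apply: Sigma0_gt2 => // n; case: n => [|n] /=; last exact: HC.
    by exists y1 => //; rewrite setCK; exact: Sigma0_one.
  apply/seteqP; split=> x /=.
    by case=> [nV|[n _ Ux]]; [exists 0%N|exists n.+1].
  by move=> [[|n] _ Ux]; [left|right; exists n].
Qed.
End WellOrder.

(** * Transfer of Borel classes from names to points *)

Section Transfer.
Variables (I : Type) (lt : I -> I -> Prop).
Hypothesis lt_wo : strict_well_order lt.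
Variables (X : topologicalType) (U : nat -> set X).
Hypotheses (U0 : forall x, U 0 x) (oU : forall n, open (U n)).

Lemma open_cylinder_image s : open (cylinder_image U s).
Proof.
elim: s => [|n s IH].
  rewrite (_ : cylinder_image _ _ = setT); first exact: openT.
  by apply/seteqP; split=> x // _ n; rewrite in_nil.
rewrite (_ : cylinder_image _ _ = U n `&` cylinder_image U s); first exact: openI.
apply/seteqP; split=> x /=.
  by move=> H; split=> [|m ms]; apply: H; rewrite inE ?eqxx // ms orbT.
by move=> [nx sx] m; rewrite inE => /predU1P[->//|/sx].
Qed.

(** The first clause does not depend on [x], so the set is either all of [cylinder_image U s] or
    empty, and open in both cases. *)
Definition forced (S : set {f | names U f}) (s : seq nat) : set X :=
  [set x | (forall y, mkseq (proj1_sig y) (size s) = s -> S y) /\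
           cylinder_image U s x].

Lemma open_forced S s : open (forced S s).
Proof.
have [HS|nS] := pselect (forall y : {f | names U f},
    mkseq (proj1_sig y) (size s) = s -> S y).
  rewrite (_ : forced S s = cylinder_image U s); first exact: open_cylinder_image.
  by apply/seteqP; split=> x; [case|split].
rewrite (_ : forced S s = set0); first exact: open0.
by apply/seteqP; split=> x // [/nS].
Qed.

(** For open [S], these are the points whose fiber meets [S] inside the cylinder [s]: the category
    quantifier at level 1. *)
Definition forced_above (S : set {f | names U f}) (s : seq nat) : set X :=
  \bigcup_(t in [set t | prefix s t]) forced S t.

Lemma open_forced_above S s : open (forced_above S s).
Proof. by apply: bigcup_open => t _; exact: open_forced. Qed.

Lemma comeager_forced S s x : forced S s x -> comeager x s S.
Proof.
by move=> [HS _]; apply: comeager_mono (comeager_setT _ _ _) => y _ ys _; exact: HS.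
Qed.

Lemma comeager_not_forced (S : set {f | names U f}) s x :
  @sub_open BaireN (names U) S ->
  ~ forced_above S s x -> comeager x s (~` S).
Proof.
move=> [W oW ->] nS; apply: comeager_mono (comeager_setT _ _ _) => y yx ys _ Wy.
have [m Hm] := open_baire oW Wy; apply: nS.
(* Long enough both to force membership in [W] and to extend [s]. *)
pose n := maxn m (size s).
exists (mkseq (proj1_sig y) n) => /=.
  by rewrite -{1}ys; apply: prefix_mkseq; exact: leq_maxr.
split=> [z|k /mapP[i _ ->]]; last by apply/yx; exists i.
rewrite size_mkseq => zy; apply: Hm.
have mn : (m <= n)%N := leq_maxl _ _.
have take_m (f : nat -> nat) : mkseq f m = take m (mkseq f n).
  by rewrite -map_take take_iota (minn_idPl mn).
by rewrite !take_m zy.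
Qed.

(* The category quantifier: [G s] collects the points over which [S] is
   nonmeager in the cylinder [s].  Carrying both alternatives through the
   induction replaces the Baire property of Borel sets. *)
Lemma Sigma0_category a (S : set {f | names U f}) :
  Sigma0 lt (@sub_open BaireN (names U)) a S ->
  exists G : seq nat -> set X, forall s,
    [/\ Sigma0 lt open a (G s),
        (forall x, G s x -> exists t,
           [/\ prefix s t, cylinder_image U t x & comeager x t S]) &
        (forall x, cylinder_image U s x -> ~ G s x -> comeager x s (~` S))].
Proof.
have [_ _ _ wf] := lt_wo.
elim/(well_founded_ind wf): a S => a IH S HS.
case: HS IH => {}a.
- move=> a0 _; exists (fun _ => set0) => s; split=> // [|x _ _].
    exact: Sigma0_zero.
  by rewrite setC0; exact: comeager_setT.
- move=> {}S a1 oS _; exists (forced_above S) => s; split=> [|x [t st Stx]|x _].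
  + by apply: Sigma0_one => //; exact: open_forced_above.
  + by exists t; split=> //; [case: Stx|exact: comeager_forced].
  + exact: comeager_not_forced.
- move=> A B a2 AB _.
  (* Numbers code pairs of a set index and a finite sequence. The default is itself such a pair, so
     it adds no new term to the union. *)
  pose idx (m : nat) : nat * seq nat := odflt (0%N, [::]) (unpickle m).
  exists (fun s => \bigcup_m
    ((if prefix s (idx m).2 then forced (A (idx m).1) (idx m).2 else set0) `\`
      forced_above (B (idx m).1) (idx m).2)) => s; split.
  + apply: (Sigma0_two (U := fun m =>
      if prefix s (idx m).2 then forced (A (idx m).1) (idx m).2 else set0)
      (V := fun m => forced_above (B (idx m).1) (idx m).2)) => // m.
    split; last exact: open_forced_above.
    by case: ifP => _; [exact: open_forced|exact: open0].
  + move=> x [m _]; move: (idx m) => [n t] /=; case: ifP => st [] // Atx nB.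
    exists t; split=> //; first by case: Atx.
    have cA := comeager_forced Atx.
    have cB : comeager x t (~` B n).
      by have [_ ?] := AB n; exact: comeager_not_forced.
    by apply: comeager_mono (comeager_setI cA cB) => y _ _ yAB; exists n.
  + move=> x sx nG; rewrite setC_bigcup; apply: comeager_bigcap => n.
    apply: comeager_local => // t st tx.
    (* Below any [t] some cylinder makes [A n] minus [B n] negligible: either [A n] is avoided above
       [t], or [t] extends to [u] forcing [A n] and then to [v] forcing [B n]. Otherwise the pair
       (n, u) would put [x] into the union. *)
    have [[u tu Aux]|nA] := pselect (forced_above (A n) t x); last first.
      exists t; split=> //; first exact: prefix_refl.
      have [oA _] := AB n.
      by apply: comeager_mono (comeager_not_forced oA nA) => y _ _ nAy [].
    have [[v uv Bvx]|nB] := pselect (forced_above (B n) u x).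
      exists v; split; [exact: prefix_trans tu uv|by case: Bvx|].
      by apply: comeager_mono (comeager_forced Bvx) => y _ _ By [].
    case: nG; exists (pickle (n, u)) => //.
    by rewrite /idx pickleK /= (prefix_trans st tu).
- move=> C a3 HC IH.
  have /choice[H HH] n : exists H : seq nat -> set X, exists2 b, lt b a & forall s,
    [/\ Sigma0 lt open b (H s),
        (forall x, H s x -> exists t,
           [/\ prefix s t, cylinder_image U t x & comeager x t (~` C n)]) &
        (forall x, cylinder_image U s x -> ~ H s x -> comeager x s (C n))].
    have [b ba Cb] := HC n; have [H HH] := IH b ba _ Cb.
    by exists H; exists b => // s; have := HH s; rewrite setCK.
  pose idx (m : nat) : nat * seq nat := odflt (0%N, [::]) (unpickle m).
  (* [H n t] is the quantifier for the complement of [C n], so outside it [C n] is comeager above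
     [t]. A union is nonmeager in [s] exactly when some [C n] is comeager above some [t] extending
     [s]. *)
  exists (fun s => \bigcup_m
    (if prefix s (idx m).2 then cylinder_image U (idx m).2 `\` H (idx m).1 (idx m).2
     else set0)) => s; split.
  + apply: Sigma0_gt2 => // m; move: (idx m) => [n t] /=; case: ifP => _.
      rewrite setCD; have [b ba /(_ t)[Hb _ _]] := HH n.
      exact: Sigma0_closedU a3 ba (open_cylinder_image t) Hb.
    have [z1 [_ [z1o _ z1a _]]] := ord_gt2_is12 lt_wo a3.
    by exists z1 => //; rewrite setC0; apply: Sigma0_one => //; exact: openT.
  + move=> x [m _]; move: (idx m) => [n t] /=; case: ifP => st [] // tx nH.
    exists t; split=> //; have [b ba /(_ t)[_ _ /(_ x tx nH)]] := HH n.
    by apply: comeager_mono => y _ _ Cy; exists n.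
  + move=> x sx nG; rewrite setC_bigcup; apply: comeager_bigcap => n.
    apply: comeager_local => // t st tx.
    have [b ba /(_ t)[_ Hc _]] := HH n; apply: Hc.
    apply: contrapT => nH; apply: nG; exists (pickle (n, t)) => //.
    by rewrite /idx pickleK /= st.
Qed.
End Transfer.

(** * Countable bases and the standard representation *)

Lemma second_countable_enum (X : topologicalType) : @second_countable X ->
  exists U : nat -> set X,
    [/\ forall n, open (U n), forall x, U 0 x
      & forall x W, nbhs x W -> exists2 n, U n x & U n `<=` W].
Proof.
move=> [B /countable_injP[f finj] [Bo Bnbhs]].
(* Index 0 is reserved for the whole space. Since [f] is injective on [B], the union has at most one
   member; it is empty when [m] codes no base set. *)
pose U n : set X := if n is m.+1 then \bigcup_(b in [set b | B b /\ f b = m]) b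
  else setT.
exists U; split=> // [[|n]|x W /Bnbhs[b [Bb bx] bW]].
- exact: openT.
- by apply: bigcup_open => b [/Bo].
- exists (f b).+1; first by exists b.
  move=> y [b' [Bb' fb'] b'y]; apply: bW.
  by rewrite -(finj b' b) ?inE.
Qed.

Section StandardRepresentation.
Variables (X : topologicalType) (U : nat -> set X).
Hypotheses
  (Unbhs : forall x W, nbhs x W -> exists2 n, U n x & U n `<=` W)
  (X_T0 : kolmogorov_space X).

Lemma enumerates_inj (f : nat -> nat) x y :
  enumerates U f x -> enumerates U f y -> x = y.
Proof.
move=> fx fy; apply/eqP; apply: contraT => /X_T0[W].
rewrite !inE => -[[nW Wn]|[nW Wn]].
- have [n nx nW'] := Unbhs nW; case: Wn; apply: nW'.
  by apply/fy; apply/fx.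
- have [n nx nW'] := Unbhs nW; case: Wn; apply: nW'.
  by apply/fx; apply/fy.
Qed.

Lemma standard_representation (x0 : X) : exists rho : BaireN -> X,
  (forall f x, enumerates U f x -> rho f = x) /\
  {within (names U : set BaireN), continuous rho}.
Proof.
have /choice[rho Hrho] (f : BaireN) : exists x, names U f -> enumerates U f x.
  have [[x fx]|nf] := pselect (names U f); first by exists x.
  by exists x0 => /nf.
have rhoE (f : BaireN) x : enumerates U f x -> rho f = x.
  by move=> fx; apply: (@enumerates_inj f) => //; apply: Hrho; exists x.
exists rho; split=> //; apply/subspace_continuousP => f [x fx].
have rf := rhoE f x fx; move=> W; rewrite [X in nbhs X]rf => /Unbhs[n nx nW].
(* One coordinate of the name secures continuity: every name with value [n] at position [i] names a
   point of [U n]. *)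
have [i fi] := (fx n).1 nx.
have oi : open (proj i @^-1` [set n] : set BaireN).
  apply: open_comp; last exact: discrete_open.
  by move=> g _; exact: proj_continuous.
have : nbhs f (proj i @^-1` [set n] : set BaireN) by exact: open_nbhs_nbhs.
apply: filterS => g gi [y gy]; apply: nW.
have rg : rho g = y by exact: rhoE.
suff : U n (rho g) by [].
by rewrite rg; apply/gy; exists i.
Qed.
End StandardRepresentation.

(** * Continuous pullbacks and partitions labeled by forests *)

Lemma within_continuous_sub_open (T : topologicalType) (D : set BaireN)
    (g : BaireN -> T) (W : set T) :
  {within D, continuous g} -> open W ->
  sub_open ((fun y : {x | D x} => g (proj1_sig y)) @^-1` W).
Proof.
move=> /continuousP gcont /gcont /open_subspaceP[V oV VW]; exists V => //.
apply/seteqP; split=> -[y Dy] /= Wy.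
- have : (V `&` D) y by rewrite VW; split.
  by case.
- have : (g @^-1` W `&` D) y by rewrite -VW; split.
  by case.
Qed.

(** Without a minimal element, repeatedly choosing a strictly smaller member of [Q] gives a strictly
    descending sequence, whose range is an infinite chain. *)
Lemma forest_minimal (P : Type) (le : P -> P -> Prop) (Q : set P) p :
  countable_forest le -> Q p ->
  exists q, Q q /\ forall r, le r q -> r <> q -> ~ Q r.
Proof.
move=> [[refl anti tr] [_ fin _]] Qp; apply: contrapT => nmin.
have /choice[g Hg] q : exists r, Q q -> [/\ le r q, r <> q & Q r].
  have [Qq|nQ] := pselect (Q q); last by exists q.
  apply: contrapT => nr; apply: nmin; exists q; split=> // r rq nrq Qr.
  by apply: nr; exists r.
pose a n := iter n g p.
have Qa n : Q (a n) by elim: n => //= n /Hg[].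
have aS n : le (a n.+1) (a n) /\ a n.+1 <> a n by have [] := Hg _ (Qa n).
have amono m n : (m <= n)%N -> le (a n) (a m).
  move=> /subnK <-; elim: (n - m)%N => [|d IH]; first exact: refl.
  exact: tr (aS (d + m)%N).1 IH.
have alt m n : (m < n)%N -> a m <> a n.
  move=> mn amn; have [am nam] := aS m; apply: nam; apply: anti => //.
  by rewrite amn; exact: amono.
have ainj : injective a.
  by move=> m n amn; case: (ltngtP m n) => // /alt; rewrite amn.
have /fin : is_chain le (range a).
  move=> _ _ [m _ <-] [n _ <-]; case: (leqP m n) => [|/ltnW] /amono; first by right.
  by left.
suff : infinite_set (range a) by [].
apply/infiniteP; rewrite (card_le_eqr (inj_card_eq _)) //.
by move=> m n _ _; exact: ainj.
Qed.

Section SigmaF.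
Variables (I : Type) (lt : I -> I -> Prop).
Hypothesis lt_wo : strict_well_order lt.
Variables (theta : I) (k : nat) (P : Type) (le : P -> P -> Prop) (c : P -> 'I_k).

Lemma SigmaF_preimage (Y Z : Type) (opY : set Y -> Prop) (opZ : set Z -> Prop)
    (h : Y -> Z) (A : Z -> 'I_k) : (forall S, opZ S -> opY (h @^-1` S)) ->
  SigmaF lt opZ theta le c A -> SigmaF lt opY theta le c (fun y => A (h y)).
Proof.
move=> hop [B [HB Bcov BA]]; exists (fun p => h @^-1` B p); split=> [p||i].
- exact: Sigma0_preimage hop _ _ (HB p).
- by rewrite -preimage_bigcup Bcov.
- transitivity (h @^-1` (A @^-1` [set i])) => //.
  rewrite BA preimage_bigcup; apply: eq_bigcupr => p _.
  by rewrite -preimage_bigcup.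
Qed.

Lemma SigmaF_standard (X : topologicalType) (U : nat -> set X) (rho : BaireN -> X)
    (A : X -> 'I_k) :
  (forall n, open (U n)) -> (forall x, U 0 x) ->
  (forall f x, enumerates U f x -> rho f = x) ->
  countable_forest le ->
  SigmaF lt (@sub_open BaireN (names U)) theta le c (fun y => A (rho (proj1_sig y))) ->
  SigmaF lt (@open X) theta le c A.
Proof.
move=> oU U0 rhoE leF [B [HB Bcov BA]].
have [_ [Pcount _ _]] := leF.
have /choice[G HG] p := Sigma0_category lt_wo U0 oU (HB p).
pose N p := G p [::].
have nilx x : cylinder_image U [::] x by move=> n; rewrite in_nil.
(* Where [N q] fails, [B q] is meager in the fiber. Countably many such sets can be avoided together
   inside a set comeager above [t]. *)
have fiber x t (Q : set P) (S : set {f | names U f}) :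
    cylinder_image U t x -> comeager x t S -> (forall q, Q q -> ~ N q x) ->
    exists y, [/\ rho (proj1_sig y) = x, S y & forall q, Q q -> ~ B q y].
  move=> tx cS NQ.
  have [y [yx [Sy QBy]]] : exists y : {f | names U f}, enumerates U (proj1_sig y) x /\
      (S `&` \bigcap_(q in Q) ~` B q) y.
    apply: (comeager_nonempty U0 tx); apply: comeager_setI cS _.
    apply: comeager_bigcap_countable => // q Qq.
    apply: comeager_prefix (prefix0s t) _; have [_ _] := HG q [::].
    by apply=> //; exact: NQ.
  by exists y; split=> //; exact: rhoE.
have BAc y p : B p y -> (forall q, le q p /\ q <> p -> ~ B q y) ->
    A (rho (proj1_sig y)) = c p.
  move=> Bpy nBy; suff : ((fun z => A (rho (proj1_sig z))) @^-1` [set c p]) y by [].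
  by rewrite BA; exists p => //; split=> // -[q qp Bqy]; exact: nBy Bqy.
have NAc x p : N p x -> (forall q, le q p /\ q <> p -> ~ N q x) -> A x = c p.
  move=> Npx nN; have [_ /(_ x Npx)[t [_ tx cB]] _] := HG p [::].
  have [y [yx Bpy nBy]] := fiber x t _ _ tx cB nN.
  by rewrite -yx; exact: BAc.
have Nmin x : exists p, N p x /\ forall q, le q p /\ q <> p -> ~ N q x.
  have [p Npx] : exists p, N p x.
    (* If no [N p] contained [x], some name of [x] would escape every [B q], although these cover
       all names. *)
    apply: contrapT => nN; have [] := fiber x [::] setT setT (nilx x).
    + exact: comeager_setT.
    + by move=> q _ Nqx; apply: nN; exists q.
    + move=> y [_ _ nB]; have : (\bigcup_p B p) y by rewrite Bcov.
      by move=> [q _ Bqy]; exact: nB Bqy.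
  have [q [Nqx qmin]] := @forest_minimal _ _ [set q | N q x] _ leF Npx.
  by exists q; split=> // r [rq nrq]; exact: qmin.
exists N; split=> [p||i].
- by have [] := HG p [::].
- by apply/seteqP; split=> // x _; have [p [Npx _]] := Nmin x; exists p.
- apply/seteqP; split=> x /=.
    move=> Ax; have [p [Npx pmin]] := Nmin x.
    exists p; first by rewrite /= -(NAc x p).
    by split=> // -[q qp Nqx]; exact: pmin Nqx.
  move=> [p <- [Npx nN]]; apply: NAc => // q qp Nqx.
  by apply: nN; exists q.
Qed.
End SigmaF.

Theorem theorem4p14
  (k : nat) (hk : (2 <= k)%N)
  (X : topologicalType) (hX2 : @second_countable X) (hX0 : kolmogorov_space X)
  (D : set BaireN) (delta : BaireN -> X) (hdelta : admissible D delta)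
  (A : X -> 'I_k)
  (I : Type) (lt : I -> I -> Prop) (hwo : strict_well_order lt)
  (theta : I) (htheta_ge1 : ~ ord_is0 lt theta)
  (htheta_ctbl : countable [set b | lt b theta])
  (P : Type) (le : P -> P -> Prop) (hF : countable_forest le) (c : P -> 'I_k) :
  SigmaF lt (@open X) theta le c A <->
  SigmaF lt (@sub_open BaireN D) theta le c (fun d : {x : BaireN | D x} => A (delta (proj1_sig d))).
Proof.
have [delta_cont _ delta_univ] := hdelta.
split=> HA.
  apply: (SigmaF_preimage hwo _ HA) => W oW.
  exact: within_continuous_sub_open.
have [U [oU U0 Unbhs]] := second_countable_enum hX2.
(* [delta (fun=> 0%N)] merely supplies a point of [X] as the value of [rho] off the names. *)
have [rho [rhoE rho_cont]] := standard_representation Unbhs hX0 (delta (fun=> 0%N)).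
have [g [g_cont gD rho_g]] := delta_univ _ _ rho_cont.
apply: (SigmaF_standard hwo oU U0 rhoE hF).
(* The reduction [g] as a map between the subspaces; the witness on [D] is pulled back along it. *)
pose h (y : {f | names U f}) : {d | D d} :=
  exist _ (g (proj1_sig y)) (gD _ (proj2_sig y)).
have -> : (fun y : {f | names U f} => A (rho (proj1_sig y))) =
    (fun y => A (delta (proj1_sig (h y)))).
  by apply/funext => -[f Uf] /=; rewrite rho_g.
apply: (SigmaF_preimage hwo (h := h) _ HA) => _ [W oW ->].
exact: (within_continuous_sub_open g_cont oW).
Qed.
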